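(* Let $T$ be a finite set, let $d_1,\dots,d_m$ be metrics on $T$, and let $(\mathcal{X}_t)_{t\in T}$ be an $\mathfrak{X}$-valued random process with a mixed tail, i.e. for $s,t\in T$ and $u\ge 0$, $$\mathrm{P}\Big(\Vert \mathcal{X}_t-\mathcal{X}_s\Vert_\alpha\ge \sum_{n=1}^m u^{1/n}d_n(s,t)\Big)\le 2e^{-u}.$$ Let $t_0\in T$. Then there is a constant $C_2>0$ such that for any $1\le p<\infty$, $$\Big(\mathbb{E}\sup_{t\in T}\Vert \mathcal{X}_t-\mathcal{X}_{t_0}\Vert_\alpha^p\Big)^{1/p}\le C_2\sum_{n=1}^m\gamma_n(T,d_n)+2\sup_{t\in T}\big(\mathbb{E}\Vert \mathcal{X}_t-\mathcal{X}_{t_0}\Vert_\alpha^p\big)^{1/p}.$$ Accordingly, there are constants $C_2, C_3$ such that for any $u\ge 1$, $$\mathrm{P}\Big(\sup_{t\in T}\Vert \mathcal{X}_t-\mathcal{X}_{t_0}\Vert_\alpha\ge C_2\sum_{n=1}^m\gamma_n(T,d_n)+C_3\sum_{n=1}^m u^{1/n}\Delta_{d_n}(T)\Big)\le e^{-u}.$$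
   Context: $\mathfrak{X}$ is a normed linear space of complex tensors of the same fixed dimensions $I_1\times\cdots\times I_M\times J_1\times\cdots\times J_N$, with $\Vert\cdot\Vert_\alpha$ a unitarily invariant norm given by a gauge function $\alpha$. An $\mathfrak{X}$-valued random process $(\mathcal{X}_t)_{t\in T}$ is a family of $\mathfrak{X}$-valued random variables on a common probability space. For a metric $d$ on $T$, $\Delta_d(T)=\sup_{s,t\in T}d(s,t)$. A sequence $\mathfrak{T}=(T_k)_{k\ge 0}$ of subsets of $T$ is admissible if $|T_0|=1$ and $|T_k|\le 2^{2^k}$ for all $k\ge 1$. For $0<\beta<\infty$, $$\gamma_\beta(T,d)=\inf_{\mathfrak{T}}\sup_{t\in T}\sum_{k=0}^\infty 2^{k/\beta}d(t,T_k),\qquad d(t,T_k)=\inf_{s\in T_k}d(t,s),$$ with the infimum over all admissible sequences; $\gamma_n(T,d_n)$ is this functional with $\beta=n$ and $d=d_n$.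
   Formalization: The mixed-tail condition is required only for s ≠ t (for s = t the event 0 ≥ 0 has probability 1, so no process could satisfy it), and the second (tail) bound assumes T has at least two points (for T = {t_0} it is false). *)

(* Defs.v *)
From HB Require Import structures.
From mathcomp Require Export all_boot all_order all_algebra perm.
From mathcomp Require Export spectral.
From mathcomp Require Export complex.
From mathcomp Require Export boolp classical_sets functions reals ereal.
From mathcomp Require Export topology normedtype sequences exp measure.
From mathcomp Require Export lebesgue_measure lebesgue_integral probability.

Set Implicit Arguments.
Unset Strict Implicit.
Unset Printing Implicit Defensive.

Import Order.TTheory GRing.Theory Num.Theory.
Local Open Scope classical_set_scope.
Local Open Scope ring_scope.

(** ** Complex tensors *)

(* Multi-indices (i_1, ..., i_M) with i_k < I_k, indexed from 0. *)
Notation midx I := {dffun forall k, 'I_(I k)}.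

Section Tensors.
Context {R : realType}.

(* The two blocks of modes of a tensor of dimensions
   I_1 x ... x I_M x J_1 x ... x J_N are kept apart, because the Einstein
   product contracts one whole block. *)
Definition tensor (M : nat) (I : 'I_M -> nat) (N : nat) (J : 'I_N -> nat) :=
  {ffun midx I * midx J -> R[i]}.

Definition tscale M (I : 'I_M -> nat) N (J : 'I_N -> nat)
    (c : R[i]) (X : tensor I J) : tensor I J :=
  [ffun ij => c * X ij].

(* Einstein product X *_N Y. *)
Definition eprod M (I : 'I_M -> nat) N (J : 'I_N -> nat) L (K : 'I_L -> nat)
    (X : tensor I J) (Y : tensor J K) : tensor I K :=
  [ffun ik => \sum_(j : midx J) X (ik.1, j) * Y (j, ik.2)].

(* Conjugate transpose X^H. *)
Definition tadj M (I : 'I_M -> nat) N (J : 'I_N -> nat)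
    (X : tensor I J) : tensor J I :=
  [ffun ji => conjc (X (ji.2, ji.1))].

Definition tid M (I : 'I_M -> nat) : tensor I I :=
  [ffun ii => (ii.1 == ii.2)%:R].

Definition tunitary M (I : 'I_M -> nat) (U : tensor I I) : Prop :=
  eprod (tadj U) U = tid I /\ eprod U (tadj U) = tid I.

(* Unfolding of a square tensor into a matrix; it turns the Einstein product
   into the matrix product, so it preserves eigenvalues. *)
Definition unfold_sq N (J : 'I_N -> nat) (H : tensor J J) :
    'M[R[i]]_#|{: midx J}| :=
  \matrix_(a, b) H (enum_val a, enum_val b).

(* Singular values of X: the eigenvalues, with multiplicity and in no
   particular order, of |X| = (X^H *_M X)^(1/2).  The eigenvalues of
   X^H *_M X are nonnegative reals, whence the real part. *)
Definition singular_values M (I : 'I_M -> nat) N (J : 'I_N -> nat)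
    (X : tensor I J) : 'rV[R]_#|{: midx J}| :=
  \row_a Num.sqrt
    (complex.Re (spectral_diag (unfold_sq (eprod (tadj X) X)) 0 a)).

(* Symmetric gauge functions: norms on R^r that are invariant under
   permutations and sign changes of the coordinates. *)
Record gauge_function (r : nat) (al : 'rV[R]_r -> R) : Prop := GaugeFunction {
  gauge_ge0 : forall x, 0 <= al x;
  gauge_eq0 : forall x, al x = 0 -> x = 0;
  gaugeZ : forall (a : R) x, al (a *: x) = `|a| * al x;
  gaugeD : forall x y, al (x + y) <= al x + al y;
  gauge_perm : forall (s : 'S_r) x, al (col_perm s x) = al x;
  gauge_abs : forall x, al (map_mx Num.norm x) = al x }.

Record tensor_norm M (I : 'I_M -> nat) N (J : 'I_N -> nat)
    (nrm : tensor I J -> R) : Prop := TensorNorm {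
  tnorm_ge0 : forall X, 0 <= nrm X;
  tnorm_eq0 : forall X, nrm X = 0 -> X = 0;
  tnormZ : forall (c : R[i]) X, nrm (tscale c X) = complex.Re `|c| * nrm X;
  tnormD : forall X Y, nrm (X + Y) <= nrm X + nrm Y }.

(* [nrm] is the unitarily invariant norm given by the gauge function [al]. *)
Record ui_norm M (I : 'I_M -> nat) N (J : 'I_N -> nat)
    (al : 'rV[R]_#|{: midx J}| -> R) (nrm : tensor I J -> R) : Prop := UiNorm {
  ui_norm_norm : tensor_norm nrm;
  ui_norm_unitary : forall (U : tensor I I) (V : tensor J J) (X : tensor I J),
    tunitary U -> tunitary V -> nrm (eprod (eprod U X) V) = nrm X;
  ui_norm_gauge : gauge_function al;
  ui_normE : forall X, nrm X = al (singular_values X) }.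

(* Tensor-valued random variables.  The Borel sigma-algebra of the
   finite-dimensional space of tensors is generated by the real and imaginary
   parts of the entries. *)
Definition tensor_rv (d : measure_display) (Om : measurableType d)
    M (I : 'I_M -> nat) N (J : 'I_N -> nat) (X : Om -> tensor I J) : Prop :=
  forall ij, measurable_fun setT (fun w => complex.Re (X w ij)) /\
             measurable_fun setT (fun w => complex.Im (X w ij)).

(** ** Metrics and the functionals of generic chaining *)

Record metric (T : Type) (d : T -> T -> R) : Prop := Metric {
  metric_ge0 : forall s t, 0 <= d s t;
  metric_eq0 : forall s t, d s t = 0 <-> s = t;
  metric_sym : forall s t, d s t = d t s;
  metric_triangle : forall s t r, d s r <= d s t + d t r }.

Definition diameter (T : Type) (d : T -> T -> R) : \bar R :=
  ereal_sup (range (fun st => (d st.1 st.2)%:E)).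

(* Equal to +oo when A is empty, as it should be in the definition of
   [gamma]; an infimum taken in R would be 0. *)
Definition dist_set (T : finType) (d : T -> T -> R) (t : T) (A : {set T}) :
    \bar R :=
  ereal_inf [set (d t s)%:E | s in [set s | s \in A]].

Definition admissible (T : finType) (Tk : nat -> {set T}) : Prop :=
  #|Tk 0%N| = 1%N /\ forall k, (1 <= k)%N -> (#|Tk k| <= 2 ^ (2 ^ k))%N.

Definition gamma (T : finType) (beta : R) (d : T -> T -> R) : \bar R :=
  ereal_inf [set ereal_sup (range (fun t =>
      (\sum_(0 <= k <oo) (2 `^ (k%:R / beta))%:E * dist_set d t (Tk k))%E))
    | Tk in [set Tk : nat -> {set T} | admissible Tk]].

(** ** Mixed tails *)

(* The metric d_n of exponent 1/n is [dd i] with n = i + 1.  Only pairs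
   s <> t are constrained: for s = t the event is 0 >= 0, of probability 1,
   and the bound could not hold for u > ln 2. *)
Definition mixed_tail (d : measure_display) (Om : measurableType d)
    (P : probability Om R) M (I : 'I_M -> nat) N (J : 'I_N -> nat)
    (nrm : tensor I J -> R) (T : finType) (m : nat)
    (dd : 'I_m -> T -> T -> R) (X : T -> Om -> tensor I J) : Prop :=
  forall (s t : T) (u : R), s <> t -> 0 <= u ->
    (P [set w | (\sum_(i < m) u `^ (i.+1%:R^-1) * dd i s t
                  <= nrm (X t w - X s w))%R]
      <= (2 * expR (- u))%:E)%E.

End Tensors.

Arguments tensor : clear implicits.
Arguments tensor R {M} I {N} J.

(* Main.v *)
Require Import Defs.
From mathcomp Require Import numfun cardinality measurable_realfun hoelder.
From mathcomp Require Import ring lra zify.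

(* Generic chaining along a single sequence of nets that is good for all the
   metrics at once.  Given p >= 1 pick l with 2^l <= p < 2^(l+1) and split
   X_t - X_{t0} at the l-th net point r_l(t) of t.  The links above level l are
   controlled by the mixed tail and a union bound, which gives a tail
   exp(-c u p) and hence a p-th moment of order sum_n gamma_n, uniformly in p.
   At level l there are at most 2^(2^l) <= 2^p points, so replacing the supremum
   by a sum costs a factor 2 after taking p-th roots.  The tail bound is Markov's
   inequality with p = u, the p-th moments of single increments being at most
   of order sum_n p^(1/n) Delta_n. *)

Set Implicit Arguments.
Unset Strict Implicit.
Unset Printing Implicit Defensive.

Import Order.TTheory GRing.Theory Num.Theory.
Local Open Scope classical_set_scope.
Local Open Scope ring_scope.

(** * Nets for one metric, and a common net for all of them *)

(** Any [S] strictly above the infimum bounds the series of some admissible sequence; as [T] is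
    finite, [q k t] can be a point of [Tk k] nearest to [t]. Constancy of [q 0] records that the
    first set is a single point. *)
Lemma gamma_lt_net (R : realType) (T : finType) (beta S : R) (d : T -> T -> R) :
  metric d -> (gamma beta d < S%:E)%E ->
  exists q : nat -> T -> T,
  [/\ forall k, (#|q k @: T| <= 2 ^ 2 ^ k)%N,
      forall s t, q 0%N s = q 0%N t &
      forall t K, \sum_(k < K) 2 `^ (k%:R / beta) * d t (q k t) <= S].
Proof.
move=> dm /ereal_inf_lt[_ [Tk [T0 Tadm] <-]] SS.
have d0 := metric_ge0 dm.
have dist0 t A : (0 <= dist_set d t A)%E.
  by apply/ereal_infP => _ [s _ <-]; rewrite lee_fin.
have w0 k : (0 < 2 `^ (k%:R / beta) :> R) by rewrite powR_gt0.
have term0 t k : (0 <= (2 `^ (k%:R / beta))%:E * dist_set d t (Tk k))%E.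
  by rewrite mule_ge0// lee_fin ltW.
have bnd t : (\sum_(0 <= k <oo) (2 `^ (k%:R / beta))%:E * dist_set d t (Tk k)
              < S%:E)%E.
  by apply: le_lt_trans SS; apply: ereal_sup_ubound; exists t.
have part t K : (\sum_(k < K) (2 `^ (k%:R / beta))%:E * dist_set d t (Tk k)
              <= S%:E)%E.
  apply: le_trans (ltW (bnd t)).
  by rewrite -(big_mkord xpredT
    (fun k => (2 `^ (k%:R / beta))%:E * dist_set d t (Tk k))%E) nneseries_lim_ge.
(* [Tk k] is nonempty: otherwise the distance is [+oo], its weight is positive, and a partial sum
   would exceed [S]. *)
have near t k : exists s, s \in Tk k /\ ((d t s)%:E <= dist_set d t (Tk k))%E.
  have [E|[s0 s0k]] := set_0Vmem (Tk k).
    have dy : dist_set d t (Tk k) = +oo%E.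
      apply/eqP; rewrite -leye_eq; apply/ereal_infP => y [s /= + _].
      by rewrite E inE.
    have := part t k.+1; rewrite big_ord_recr /= dy gt0_muley ?lte_fin//.
    by rewrite addey ?leye_eq// gt_eqF// (lt_le_trans (ltNyr 0))// sume_ge0.
  case: (@arg_minP _ _ _ s0 (fun s => s \in Tk k) (d t) s0k) => s sk smin.
  exists s; split=> //; apply/ereal_infP => _ [r /= rk <-].
  by rewrite lee_fin smin.
have [q qP] : {q : T -> nat -> T & forall t k,
    q t k \in Tk k /\ ((d t (q t k))%:E <= dist_set d t (Tk k))%E}.
  exists (fun t k => sval (cid (near t k))) => t k; exact: svalP (cid (near t k)).
exists (fun k t => q t k); split=> [k|s t|t K].
- have sub : (fun t => q t k) @: T \subset Tk k.
    by apply/fintype.subsetP => _ /imsetP[t _ ->]; case: (qP t k).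
  apply: leq_trans (subset_leq_card sub) _.
  by case: k {sub} => [|k]; [rewrite T0|apply: Tadm].
- have [a Ta] : exists a, Tk 0%N = [set a]%SET by apply/cards1P; rewrite T0.
  have h u : q u 0%N = a.
    by have [+ _] := qP u 0%N; rewrite Ta inE => /eqP.
  by rewrite !h.
- rewrite -lee_fin; apply: le_trans (part t K).
  rewrite -sumEFin; apply: lee_sum => k _.
  rewrite EFinM; apply: lee_wpmul2l; first by rewrite lee_fin ltW.
  by have [] := qP t k.
Qed.

(* The level of w is the number of times, at most k, that w can be doubled
   while staying below S. *)
Lemma dyadic_level (R : realType) (S : R) (k : nat) :
  exists lev : R -> 'I_k.+1, forall w w' : R, 0 <= w -> 0 <= w' <= S ->
    lev w = lev w' -> w' <= 2 * w + S / 2 ^+ k.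
Proof.
(* The first disjunct keeps level 0 available, so the maximum exists even for [w] above [S]. *)
pose P w (j : 'I_k.+1) := (j == ord0) || (2 ^+ j * w <= S).
have P0 w : P w ord0 by rewrite /P eqxx.
exists (fun w => [arg max_(j > ord0 | P w j) (j : nat)]%N) => w w' w0 /andP[w'0 w'S].
case: arg_maxnP => // j Pj jmax; case: arg_maxnP => // j' Pj' _ E.
rewrite -{j'}E in Pj'.
have pj : 2 ^+ j * w' <= S.
  by case/orP: Pj' => [/eqP->|//]; rewrite expr0 mul1r.
have p2 n : (0 < 2 ^+ n :> R) by rewrite exprn_gt0.
(* At the top level [w' <= S / 2^k]; below it, maximality of [j] for [w] gives
   [2^(j+1) w > S >= 2^j w']. *)
have [jk|kj] := ltnP j k; last first.
  have jk : j = k :> nat by apply/eqP; rewrite eqn_leq kj -ltnS ltn_ord.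
  rewrite jk in pj.
  have h : w' <= S / 2 ^+ k by rewrite ler_pdivlMr // mulrC.
  by apply: (le_trans h); rewrite lerDr mulr_ge0.
have : ~~ P w (Ordinal (jk : j.+1 < k.+1)%N).
  by apply/negP => /jmax /=; rewrite ltnn.
rewrite /P /= -ltNge exprS -mulrA => h.
have S0 : 0 <= S by apply: le_trans w'S.
have : w' <= 2 * w.
  by rewrite -(ler_pM2l (p2 j)) (le_trans pj)// (le_trans (ltW h))// mulrCA.
move=> /le_trans; apply; rewrite lerDl divr_ge0 // ltW//.
Qed.

Lemma sum_inv_pow2_le (R : realType) (n : nat) :
  \sum_(k < n) (2 ^+ k)^-1 <= 2 :> R.
Proof.
suff -> : \sum_(k < n) (2 ^+ k)^-1 = 2 - 2 * (2 ^+ n)^-1 :> R.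
  by rewrite gerBl mulr_ge0// invr_ge0 exprn_ge0.
elim: n => [|n IH]; first by rewrite big_ord0 expr0 invr1 mulr1 subrr.
rewrite big_ord_recr IH /= exprS invfM.
have : (2 ^+ n != 0 :> R) by rewrite expf_neq0.
by move=> ?; field.
Qed.

(* Common refinement of the m nets: two points share a representative when, in
   every metric, they have the same nearest point and their distances to it are
   at the same dyadic level.  Remembering the level is what bounds the distance
   to the representative; the number of levels, k + 1, is harmless. *)
Lemma joint_net (R : realType) (T : finType) (t0 : T) (m : nat)
    (dd : 'I_m -> T -> T -> R)
    (wt : 'I_m -> nat -> R) (S : 'I_m -> R) (q : 'I_m -> nat -> T -> T) :
  (forall i, metric (dd i)) -> (forall i k, 0 <= wt i k) ->
  (forall i k, (#|q i k @: T| <= 2 ^ 2 ^ k)%N) ->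
  (forall i t K, \sum_(k < K) wt i k * dd i t (q i k t) <= S i) ->
  exists r : nat -> T -> T,
  (forall k, (#|r k @: T| <= 2 ^ (2 * m * 2 ^ k))%N) /\
  forall i t K, \sum_(k < K) wt i k * dd i t (r k t) <= 5 * S i.
Proof.
move=> dm wt0 qcard qsum.
have d0 i := metric_ge0 (dm i).
have term0 i k t s : 0 <= wt i k * dd i t s by rewrite mulr_ge0.
have S0 i : 0 <= S i by apply: le_trans (qsum i t0 0%N); rewrite big_ord0.
have termS i k t : wt i k * dd i t (q i k t) <= S i.
  by apply: le_trans (qsum i t k.+1); rewrite big_ord_recr lerDr sumr_ge0.
have lev' i k := cid (dyadic_level (S i) k).
pose lev i k := sval (lev' i k); have levP i k := svalP (lev' i k).
pose key k t : {ffun 'I_m -> T * 'I_k.+1} :=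
  [ffun i => (q i k t, lev i k (wt i k * dd i t (q i k t)))].
pose g k x := odflt t0 [pick s | key k s == x].
pose r k t := g k (key k t).
have rkey k t : key k (r k t) = key k t.
  by rewrite /r /g; case: pickP => [s /eqP|/(_ t)]//=; rewrite eqxx.
exists r; split=> [k|i t K].
  have -> : r k @: T = g k @: (key k @: T) by rewrite -imset_comp.
  apply: leq_trans (leq_imset_card _ _) _.
  pose F (i : 'I_m) := [predX q i k @: T & predT : pred 'I_k.+1].
  have sub : key k @: T \subset family F.
    apply/fintype.subsetP => _ /imsetP[t _ ->]; apply/familyP => i.
    by rewrite ffunE inE /= imset_f.
  apply: leq_trans (subset_leq_card sub) _.
  (* At most 2^(2^k) net points times [k + 1] levels, and [k + 1 <= 2^(2^k)]. *)
  have F_card i : (#|F i| <= 2 ^ (2 * 2 ^ k))%N.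
    rewrite cardX card_ord mul2n -addnn expnD leq_mul//.
    by rewrite (leq_trans (ltn_expl k (isT : (1 < 2)%N)))// ltnW// ltn_expl.
  rewrite card_family mulnAC expnM.
  rewrite /image_mem -[X in (_ <= _ ^ X)%N](size_enum_ord m).
  elim: (enum _) => //= i s IH.
  by rewrite expnS; apply: leq_mul (F_card i) IH.
(* The weighted distance from [r k t] to the net point it shares with [t] is at most twice that from
   [t], plus [S i / 2^k]; the triangle inequality makes the factor 3. Summed over [k], the errors
   add [2 * S i]. *)
have step (k : nat) : wt i k * dd i t (r k t) <=
    3 * (wt i k * dd i t (q i k t)) + S i / 2 ^+ k.
  move/(congr1 (fun f : {ffun 'I_m -> T * 'I_k.+1} => f i)): (rkey k t).
  rewrite !ffunE => -[eq_q eq_lev].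
  have w'S : 0 <= wt i k * dd i (r k t) (q i k (r k t)) <= S i by rewrite term0 termS.
  have := levP i k _ _ (term0 i k t (q i k t)) w'S (esym eq_lev).
  rewrite eq_q => h.
  have := ler_wpM2l (wt0 i k) (metric_triangle (dm i) t (q i k t) (r k t)).
  rewrite (metric_sym (dm i) (q i k t)) mulrDr => /le_trans; apply.
  by move: h; lra.
apply: (@le_trans _ _ (\sum_(k < K)
    (3 * (wt i k * dd i t (q i k t)) + S i / 2 ^+ k))).
  by apply: ler_sum => k _; apply: step.
rewrite big_split -mulr_sumr /=.
have -> : 5 * S i = 3 * S i + 2 * S i by ring.
apply: lerD; first by rewrite ler_pM2l ?qsum.
rewrite -mulr_sumr mulrC ler_wpM2r//.
exact: sum_inv_pow2_le.
Qed.

(* Each net has to be delayed until it fits in the cardinality allowed for a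
   single admissible sequence; before that it is constant, at the cost of a
   diameter. *)
Lemma joint_admissible_net (R : realType) (m : nat) : exists2 A : R, 0 < A &
  forall (T : finType) (t0 : T) (dd : 'I_m -> T -> T -> R) (S : 'I_m -> R),
  (forall i, metric (dd i)) ->
  (forall i : 'I_m, gamma i.+1%:R (dd i) < (S i)%:E)%E ->
  exists (r : nat -> T -> T) (K : nat),
  [/\ forall k, (#|r k @: T| <= 2 ^ 2 ^ k)%N,
      forall t k, (K <= k)%N -> r k t = t &
      forall (i : 'I_m) t n, \sum_(k < n) 2 `^ (k%:R / i.+1%:R) * dd i t (r k t)
        <= A * S i].
Proof.
(* The delay: the 2^(c 2^k) points of the joint net at level [k] fit into 2^(2^(k+c)), since
   [c <= 2^c]. *)
pose c := (2 * m)%N.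
(* The delay multiplies weights by at most [2^c]. Each of the first [c] levels costs at most [2^c]
   times a diameter, itself at most [2 * S i]; the 5 comes from the joint net. *)
exists (2 ^+ c * (2 * c%:R + 5)); first by rewrite mulr_gt0 ?exprn_gt0// ltr_wpDl ?mulr_ge0.
move=> T t0 dd S dm gS.
have d0 i := metric_ge0 (dm i).
have := fun i => gamma_lt_net (dm i) (gS i).
move=> /choice[q qP].
pose wt (i : 'I_m) (k : nat) : R := 2 `^ (k%:R / i.+1%:R).
have wt0 i k : 0 <= wt i k by rewrite powR_ge0.
have wtD i k l : wt i (k + l)%N = wt i k * wt i l.
  by rewrite /wt natrD mulrDl powRD// implybE orbC pnatr_eq0.
have wt_le i k : wt i k <= 2 ^+ k.
  rewrite /wt -powR_mulrn// ler_powR ?ler1n// ler_pdivrMr// ler_peMr//.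
  by rewrite ler1n.
have q_card (i : 'I_m) k : (#|q i k @: T| <= 2 ^ 2 ^ k)%N by case: (qP i).
have q_sum i t K : \sum_(k < K) wt i k * dd i t (q i k t) <= S i.
  by case: (qP i) => _ _; apply.
have [r [rcard rsum]] := joint_net t0 dm wt0 q_card q_sum.
(* At level 0 the weight is 1 and the net is one point, so every point is within [S i] of it. *)
have dS i s t : dd i s t <= 2 * S i.
  have h u : dd i u (q i 0%N u) <= S i.
    have [_ _ /(_ u 1%N)] := qP i.
    by rewrite big_ord1 mul0r powRr0 mul1r.
  have [_ q0 _] := qP i.
  have := metric_triangle (dm i) s (q i 0%N s) t.
  rewrite (metric_sym (dm i) (q i 0%N s) t) {2}(q0 s t).
  by have := h s; have := h t; lra.
(* From level [#|T|] on, the identity is small enough to serve as a net, so every chain is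
   finite. *)
pose K := #|T|.
exists (fun k t => if (K <= k)%N then t else if (c <= k)%N then r (k - c)%N t else t0), K.
split=> [k|t k ->//|i t n].
- case: (leqP K k) => Kk.
    apply: leq_trans (max_card _) _; apply: (leq_trans Kk).
    by apply/ltnW/(@ltn_trans (2 ^ k)%N); apply: ltn_expl.
  case: (leqP c k) => ck.
    apply: leq_trans (rcard _) _; rewrite leq_exp2l//.
    rewrite -[in leqRHS](subnK ck) expnD mulnC.
    by rewrite leq_mul2l (ltnW (ltn_expl _ _)) ?orbT.
  apply: (@leq_trans #|[set t0]%SET|).
    by apply/subset_leq_card/fintype.subsetP => _ /imsetP[? _ ->]; rewrite inE.
  by rewrite cards1 expn_gt0.
(* Identity levels contribute 0, so putting the delayed net there only increases the sum; the first
   [c] levels then split off. *)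
- apply: (@le_trans _ _ (\sum_(k < c + n) wt i k *
      dd i t (if (c <= k)%N then r (k - c)%N t else t0))).
    rewrite addnC big_split_ord /= -[leLHS]addr0; apply: lerD; last first.
      by apply: sumr_ge0 => k _; rewrite mulr_ge0.
    apply: ler_sum => k _; case: (leqP K k) => // _.
    by rewrite (metric_eq0 (dm i) t t).2// mulr0 mulr_ge0.
  rewrite big_split_ord /= mulrDr mulrDl; apply: lerD.
    have -> : 2 ^+ c * (2 * c%:R) * S i = \sum_(k < c) (2 ^+ c * (2 * S i)).
      by rewrite sumr_const card_ord -mulr_natr; ring.
    apply: ler_sum => k _; rewrite ler_pM//.
    apply: (le_trans (wt_le i k)); rewrite ler_weXn2l ?ler1n//.
    by rewrite ltnW.
  have -> : 2 ^+ c * 5 * S i = 2 ^+ c * (5 * S i) by rewrite mulrA.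
  apply: le_trans (ler_wpM2l (exprn_ge0 c (ler0n R 2)) (rsum i t n)).
  rewrite mulr_sumr; apply: ler_sum => k _.
  by rewrite leq_addr addKn wtD mulrA ler_wpM2r// ler_wpM2r.
Qed.

(** Two distinct points cannot both lie within a quarter of their distance of the single point of
    level 0. Positivity is what makes twice [gamma] a strict upper bound later. *)
Lemma gamma_gt0 (R : realType) (T : finType) (beta : R) (d : T -> T -> R) :
  metric d -> (1 < #|T|)%N -> (0 < gamma beta d)%E.
Proof.
move=> dm /card_gt1P[s [t [_ _ /eqP st]]].
have d0 := metric_ge0 dm.
have dst : 0 < d s t.
  by rewrite lt_neqAle d0 andbT eq_sym; apply/eqP => /(metric_eq0 dm).
apply: lt_le_trans (_ : (d s t / 4)%:E <= _)%E; first by rewrite lte_fin divr_gt0.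
rewrite leNgt; apply/negP => /(gamma_lt_net dm)[q [_ q0 qS]].
have h u : d u (q 0%N u) <= d s t / 4.
  by have := qS u 1%N; rewrite big_ord1 mul0r powRr0 mul1r.
have := metric_triangle dm s (q 0%N s) t.
rewrite (metric_sym dm (q 0%N s) t) {2}(q0 s t).
by have := h s; have := h t; lra.
Qed.

Lemma gamma_ge0 (R : realType) (T : finType) (t0 : T) (beta : R)
    (d : T -> T -> R) : metric d -> (0 <= gamma beta d)%E.
Proof.
move=> dm; apply/ereal_infP => _ [Tk _ <-].
apply: le_trans (ereal_sup_ubound _); last by exists t0.
apply: nneseries_ge0 => k _ _; rewrite mule_ge0 ?lee_fin ?powR_ge0//.
by apply/ereal_infP => _ [s _ <-]; rewrite lee_fin (metric_ge0 dm).
Qed.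

(** * Measurability of the norm of a random tensor *)

Section Measurability.
Context {R : realType} {M : nat} {I : 'I_M -> nat} {N : nat} {J : 'I_N -> nat}.
Implicit Types X Y : tensor R I J.

Definition tensor_l1 X : R :=
  \sum_ij (`|complex.Re (X ij)| + `|complex.Im (X ij)|).

(** Expand [X] in the tensors with a single entry 1 and use |z| <= |Re z| + |Im z|; [L] is the sum
    of the norms of these tensors. With the triangle inequality, [nrm] is Lipschitz. *)
Lemma tensor_norm_le_l1 (nrm : tensor R I J -> R) : tensor_norm nrm ->
  exists2 L, 0 <= L & forall X, nrm X <= L * tensor_l1 X.
Proof.
move=> nn; have n0 := tnorm_ge0 nn.
pose e (ij : midx I * midx J) : tensor R I J := [ffun kl => (kl == ij)%:R].
exists (\sum_ij nrm (e ij)); first exact: sumr_ge0.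
move=> X.
have XE : X = \sum_ij tscale (X ij) (e ij).
  apply/ffunP => kl; rewrite sum_ffunE (bigD1 kl)//= !ffunE eqxx mulr1.
  by rewrite big1 ?addr0// => ij ne; rewrite !ffunE eq_sym (negPf ne) mulr0.
have nsum : nrm X <= \sum_ij nrm (tscale (X ij) (e ij)).
  rewrite {1}XE; elim/big_ind2: _ => [|x1 x2 y1 y2 h1 h2|//].
    have -> : (0 : tensor R I J) = tscale 0 0.
      by apply/ffunP => ij; rewrite !ffunE mul0r.
    by rewrite (tnormZ nn) normr0 mul0r.
  by apply: le_trans (tnormD nn _ _) (lerD h1 h2).
apply: (le_trans nsum); rewrite mulr_sumr; apply: ler_sum => ij _.
rewrite (tnormZ nn) mulrC ler_pM//.
  by case: (X ij) => a b /=; rewrite sqrtr_ge0.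
  by rewrite (bigD1 ij)//= lerDl sumr_ge0.
case: (X ij) => a b /=.
rewrite -(@ler_pXn2r _ 2)// ?nnegrE ?sqrtr_ge0 ?addr_ge0// sqr_sqrtr ?addr_ge0 ?sqr_ge0//.
rewrite sqrrD !real_normK ?num_real//.
by rewrite lerD2r lerDl mulrn_wge0// mulr_ge0.
Qed.

Context {d : measure_display} {Om : measurableType d}.

(** By the Lipschitz bound, [c < nrm (Z w)] holds exactly when [c < nrm Q - L * tensor_l1 (Z w - Q)]
    for some tensor [Q] with rational entries: a countable union of events expressed through the
    entries. *)
Lemma measurable_tensor_norm (nrm : tensor R I J -> R) (Z : Om -> tensor R I J) :
  tensor_norm nrm -> tensor_rv Z -> measurable_fun setT (fun w => nrm (Z w)).
Proof.
move=> nn mZ; have [L L0 nL] := tensor_norm_le_l1 nn.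
pose tens (Q : {ffun midx I * midx J -> rat * rat}) : tensor R I J :=
  [ffun ij => Complex (ratr (Q ij).1) (ratr (Q ij).2)].
have nB X Y : nrm X - nrm Y <= L * tensor_l1 (X - Y).
  rewrite lerBlDr; apply: le_trans (lerD (nL (X - Y)) (lexx (nrm Y))).
  by have := tnormD nn (X - Y) Y; rewrite subrK.
have l1C X Y : tensor_l1 (X - Y) = tensor_l1 (Y - X).
  apply: eq_bigr => ij _; rewrite !ffunE.
  by case: (X ij) (Y ij) => [a b] [a' b'] /=; rewrite distrC (distrC b).
move=> mT; apply: (measurability _ (RGenOInfty.measurableE R)) => //.
move=> _ [_ [c ->] <-]; rewrite preimage_itvoy setTI.
rewrite [X in measurable X](_ : _ = \bigcup_(Q in setT)
  [set w | c < nrm (tens Q) - L * tensor_l1 (Z w - tens Q)]); last first.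
  apply/seteqP; split => [w /= cw|w [Q _] /= /lt_le_trans]; last first.
    by apply; rewrite lerBlDr addrC -lerBlDr l1C.
  pose K : R := \sum_(ij : midx I * midx J) 2.
  have K0 : 0 <= K by apply: sumr_ge0.
  (* Rounding costs [L * K * ep] twice, in the Lipschitz bound and in the subtracted term; the added
     1 keeps the total strictly below [nrm (Z w) - c]. *)
  pose ep : R := (nrm (Z w) - c) / (2 * L * K + 1).
  have D0 : 0 < 2 * L * K + 1 by rewrite ltr_wpDl ?mulr_ge0.
  have ep0 : 0 < ep by rewrite divr_gt0 ?subr_gt0.
  have rat_near (x : R) : exists q : rat, `|x - ratr q| <= ep.
    have [|q] := @rat_in_itvoo R (x - ep) (x + ep); first by lra.
    by rewrite in_itv /= => /andP[? ?]; exists q; rewrite ler_norml; lra.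
  have ratC (z : R[i]) : exists q : rat * rat,
      `|complex.Re z - ratr q.1| <= ep /\ `|complex.Im z - ratr q.2| <= ep.
    have [q1 h1] := rat_near (complex.Re z).
    have [q2 h2] := rat_near (complex.Im z).
    by exists (q1, q2).
  pose Q : {ffun midx I * midx J -> rat * rat} := [ffun ij => sval (cid (ratC (Z w ij)))].
  exists Q => //=.
  have l1Q : tensor_l1 (Z w - tens Q) <= K * ep.
    rewrite mulr_suml; apply: ler_sum => ij _; rewrite !ffunE.
    case: cid => q /= [h1 h2].
    by case: (Z w ij) h1 h2 => a b /= h1 h2; lra.
  have h1 := nB (Z w) (tens Q).
  have h2 : L * tensor_l1 (Z w - tens Q) <= L * (K * ep) by rewrite ler_wpM2l.
  have h3 : (2 * L * K + 1) * ep = nrm (Z w) - c by rewrite mulrC divfK ?gt_eqF.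
  by lra.
apply: countable_bigcupT_measurable => [|Q]; first exact: countableP.
rewrite -[X in measurable X]setTI -preimage_itvoy; apply: measurable_funB => //.
apply: measurable_funM => //; apply: measurable_sum => ij.
have [mRe mIm] := mZ ij.
apply: measurable_funD; apply: measurableT_comp => //.
- rewrite [X in measurable_fun _ X](_ : _ =
      fun w => complex.Re (Z w ij) - ratr (Q ij).1).
    exact: measurable_funB.
  by apply/funext => w; rewrite !ffunE; case: (Z w ij).
- rewrite [X in measurable_fun _ X](_ : _ =
      fun w => complex.Im (Z w ij) - ratr (Q ij).2).
    exact: measurable_funB.
  by apply/funext => w; rewrite !ffunE; case: (Z w ij).
Qed.

Lemma tensor_rvB (Z Z' : Om -> tensor R I J) :
  tensor_rv Z -> tensor_rv Z' -> tensor_rv (fun w => Z w - Z' w).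
Proof.
move=> mZ mZ' ij; have [m1 m2] := mZ ij; have [m1' m2'] := mZ' ij.
split.
- rewrite [X in measurable_fun _ X](_ : _ =
      fun w => complex.Re (Z w ij) - complex.Re (Z' w ij)).
    exact: measurable_funB.
  by apply/funext => w; rewrite !ffunE; case: (Z w ij) (Z' w ij) => ? ? [].
- rewrite [X in measurable_fun _ X](_ : _ =
      fun w => complex.Im (Z w ij) - complex.Im (Z' w ij)).
    exact: measurable_funB.
  by apply/funext => w; rewrite !ffunE; case: (Z w ij) (Z' w ij) => ? ? [].
Qed.

End Measurability.

(** * Moments from tail bounds, and the union bound *)

Lemma measurable_superlevel (R : realType) (d : measure_display)
    (Om : measurableType d) (a : R) (f : Om -> R) :
  measurable_fun setT f -> measurable [set w | a <= f w].
Proof.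
move=> mf; rewrite -[X in measurable X]setTI -preimage_itvcy.
by apply: mf => //; exact: measurable_itv.
Qed.

(* Split at the values 2^j * 16 * G of Z. *)
Lemma moment_of_tail (R : realType) (d : measure_display) (Om : measurableType d)
    (P : probability Om R) (Z : Om -> R) (p G : R) :
  1 <= p -> 0 < G -> measurable_fun setT Z -> (forall w, 0 <= Z w) ->
  (forall u : R, 6 <= u ->
    (P [set w | (u * G <= Z w)%R] <= (4 * expR (- (p * u / 4)))%:E)%E) ->
  ('E_P[fun w => (Z w `^ p)%R] <= ((80 * G)%R `^ p)%:E)%E.
Proof.
move=> p1 G0 mZ Z0 tail.
have p0 : 0 <= p by lra.
have G16 : 0 < 16 * G by rewrite mulr_gt0.
pose B : R := (16 * G) `^ p.
have B0 : 0 <= B by apply: powR_ge0.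
have BE c : 0 <= c -> (16 * c * G) `^ p = B * c `^ p.
  by move=> c0; rewrite mulrAC powRM// mulr_ge0// ltW.
pose A j := [set w | 16 * 2 ^+ j * G <= Z w].
have mA j : measurable (A j) by apply: measurable_superlevel.
(* The p-th power of 16 * 2^(j+1) * G, the upper end of the dyadic shell whose lower end defines
   [A j]. *)
pose c j : R := B * (2 ^+ j.+1) `^ p.
have c0 j : 0 <= c j by rewrite mulr_ge0// powR_ge0.
pose f j w : \bar R := ((c j)%:E * (\1_(A j) w)%:E)%E.
have f0 j w : (0 <= f j w)%E by rewrite mule_ge0// lee_fin.
have mf j : measurable_fun setT (f j).
  by apply: measurable_funeM; apply/measurable_EFinP; exact: measurable_indic.
have Zp_le w : ((Z w `^ p)%:E <= B%:E + \sum_(0 <= j <oo) f j w)%E.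
  have s0 : (0 <= \sum_(0 <= j <oo) f j w)%E by apply: nneseries_ge0.
  have [Zs|Zb] := ltP (Z w) (16 * G).
    rewrite -[leLHS]adde0; apply: leeD => //.
    by rewrite lee_fin; apply: ge0_ler_powR; rewrite ?nnegrE ?Z0 ?(ltW Zs) ?(ltW G16).
  have ex : exists j, Z w < 16 * 2 ^+ j * G.
    exists (Num.bound (Z w / (16 * G))).
    rewrite mulrAC mulrC -ltr_pdivrMr //.
    apply: lt_le_trans (archi_boundP _) _; first by rewrite divr_ge0 ?Z0 ?ltW.
    by rewrite -natrX ler_nat ltnW// ltn_expl.
  case: (ex_minnP ex) => -[|j] jP jmin.
    by move: jP; rewrite expr0 mulr1 ltNge Zb.
  have jA : A j w.
    by rewrite /A /= leNgt; apply/negP => /jmin; rewrite ltnn.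
  apply: (@le_trans _ _ (f j w)).
    rewrite /f indicE mem_set// mule1 lee_fin /c -BE ?exprn_ge0//.
    by apply: ge0_ler_powR; rewrite ?nnegrE ?mulr_ge0 ?exprn_ge0 ?(ltW G0) ?(ltW jP).
  apply: le_trans (leeDr _ (_ : 0 <= B%:E)%E); last by rewrite lee_fin.
  apply: le_trans (nneseries_lim_ge j.+1 (fun k _ _ => f0 k w)).
  by rewrite big_nat_recr//= leeDr// sume_ge0.
rewrite unlock.
apply: (@le_trans _ _ (\int[P]_w (B%:E + \sum_(0 <= j <oo) f j w))%E).
  apply: ge0_le_integral => //.
  - by move=> w _; rewrite lee_fin powR_ge0.
  - apply/measurable_EFinP.
    by apply: (measurableT_comp (measurable_powR p)).
  - apply: emeasurable_funD => //.
    by apply: ge0_emeasurable_sum => // k w _ _; apply: f0.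
rewrite ge0_integralD//; last 2 first.
  by move=> w _; apply: nneseries_ge0.
  by apply: ge0_emeasurable_sum => // k w _ _; apply: f0.
rewrite integral_cst// [X in (_ * X)%E]probability_setT mule1.
rewrite integral_nneseries//.
(* The tail at [u = 16 * 2^j] is 4 exp(-4 p 2^j). As [j + 1 <= 2^j] and [p >= 1], it absorbs
   (2^(j+1))^p <= e^(p (j+1)) and leaves at most 4 / 2^(j+1). *)
have term j : (\int[P]_w f j w <= (B * (4 / 2 ^+ j.+1))%:E)%E.
  rewrite ge0_integralZl_EFin//; last first.
    by apply/measurable_EFinP; exact: measurable_indic.
  rewrite integral_indic// setIT.
  have u6 : 6 <= 16 * 2 ^+ j :> R.
    have : 1 <= 2 ^+ j :> R by rewrite exprn_ege1// ler1n.
    by lra.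
  apply: le_trans (lee_wpmul2l _ (tail _ u6)) _; first by rewrite lee_fin.
  rewrite -EFinM lee_fin /c -!mulrA ler_wpM2l//.
  rewrite mulrCA ler_wpM2l//.
  have e2 : 2 <= expR 1 :> R by have := expR_ge1Dx (1 : R); lra.
  have pj : (2 ^+ j.+1) `^ p <= expR (p * j.+1%:R).
    have -> : (2 ^+ j.+1) `^ p = (2 `^ p) ^+ j.+1 :> R.
      rewrite -(powR_mulrn _ (ler0n R 2)) -(powR_mulrn _ (powR_ge0 2 p)).
      exact: powRAC.
    rewrite expRM_natr.
    rewrite lerXn2r// ?nnegrE ?powR_ge0 ?expR_ge0//.
    have -> : expR p = expR 1 `^ p by rewrite -expRM mul1r.
    by rewrite ge0_ler_powR ?nnegrE ?expR_ge0.
  have jn : j.+1%:R <= 2 ^+ j :> R by rewrite -natrX ler_nat ltn_expl.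
  have q1 : (2 ^+ j.+1)^-1 >= expR (- j.+1%:R) :> R.
    rewrite expRN lef_pV2 ?posrE ?expR_gt0 ?exprn_gt0//.
    by rewrite -[j.+1%:R]mul1r expRM_natr lerXn2r// ?nnegrE ?expR_ge0.
  apply: le_trans q1; apply: le_trans (ler_wpM2r (expR_ge0 _) pj) _.
  rewrite -expRD ler_expR.
  have h1 : p * j.+1%:R <= p * 2 ^+ j by rewrite ler_wpM2l.
  have h2 : 1 * j.+1%:R <= p * 2 ^+ j by rewrite ler_pM// ler0n.
  have h3 : 0 <= p * 2 ^+ j by rewrite mulr_ge0// exprn_ge0.
  by lra.
apply: (@le_trans _ _ (B%:E + (B * 4)%:E)%E).
  apply: leeD => //; apply: lime_le.
    by apply: is_cvg_nneseries => j _ _; apply: integral_ge0 => w _; apply: f0.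
  apply: nearW => n.
  apply: (@le_trans _ _ (\sum_(0 <= j < n) (B * (4 / 2 ^+ j.+1))%:E)%E).
    by apply: lee_sum => j _; apply: term.
  rewrite sumEFin lee_fin -mulr_sumr ler_wpM2l//.
  have -> : \sum_(0 <= j < n) (4 / 2 ^+ j.+1) = 2 * \sum_(j < n) (2 ^+ j)^-1 :> R.
    rewrite big_mkord mulr_sumr; apply: eq_bigr => j _.
    have : (2 ^+ j != 0 :> R) by rewrite expf_neq0.
    by move=> ?; rewrite exprS; field.
  by have := sum_inv_pow2_le R n; lra.
rewrite -EFinD lee_fin.
(* The total is [5 * B], and [5 <= 5^p] moves the 5 inside the power. *)
have -> : (80 * G) = 5 * (16 * G) by ring.
rewrite powRM ?mulr_ge0 ?(ltW G0)// -/B.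
have h5 : 5 <= 5 `^ p :> R by rewrite -[leLHS](@powRr1 _ 5)// ler_powR// ler1n.
have := ler_wpM2r B0 h5; lra.
Qed.

Lemma measure_le_fin_union (R : realType) (d : measure_display)
    (Om : measurableType d) (P : probability Om R) (I : finType) (Q : pred I)
    (F : I -> set Om) (B : set Om) :
  measurable B -> (forall i, measurable (F i)) ->
  (forall w, B w -> exists2 i, Q i & F i w) ->
  (P B <= \sum_(i | Q i) P (F i))%E.
Proof.
move=> mB mF BF.
have mU s : measurable (\big[setU/set0]_(i <- s | Q i) F i).
  exact: bigsetU_measurable.
apply: (@le_trans _ _ (P (\big[setU/set0]_(i | Q i) F i))).
  apply: le_measure; rewrite ?inE// => w /BF[i Qi Fi].
  by rewrite (bigD1 i)//=; left.
elim: (index_enum I) => [|i s IH]; first by rewrite !big_nil measure0.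
rewrite !big_cons; case: ifP => // Qi.
by apply: le_trans; [apply: measureU2|apply: leeD].
Qed.

(** * Suprema over a finite index set *)

Section FiniteSup.
Context {R : realType} {T : finType} (t0 : T).
Implicit Type f : T -> R.

Lemma sup_range_max f : exists2 t, sup (range f) = f t & forall s, f s <= f t.
Proof.
case: (@arg_maxP _ _ _ t0 xpredT f isT) => t _ tmax.
have fmax s : f s <= f t by apply: tmax.
exists t => //; apply/eqP; rewrite eq_le; apply/andP; split.
  by apply: ge_sup; [exists (f t), t|move=> _ [s _ <-]].
by apply: ub_le_sup; [exists (f t) => _ [s _ <-]|exists t].
Qed.

Lemma le_sup_range f t : f t <= sup (range f).
Proof. by have [s -> ] := sup_range_max f. Qed.

Lemma sup_range_ge0 f : (forall t, 0 <= f t) -> 0 <= sup (range f).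
Proof. by move=> f0; have [s ->] := sup_range_max f. Qed.

Lemma sup_range_powR f (p : R) : 0 <= p -> (forall t, 0 <= f t) ->
  sup (range (fun t => f t `^ p)) = sup (range f) `^ p.
Proof.
move=> p0 f0; have [t -> tmax] := sup_range_max f.
have [s -> smax] := sup_range_max (fun t => f t `^ p).
apply/eqP; rewrite eq_le smax andbT.
by rewrite ge0_ler_powR ?nnegrE.
Qed.

Lemma measurable_sup_range (d : measure_display) (Om : measurableType d)
    (f : T -> Om -> R) : (forall t, measurable_fun setT (f t)) ->
  measurable_fun setT (fun w => sup (range (fun t => f t w))).
Proof.
move=> mf mT; apply: (measurability _ (RGenOInfty.measurableE R)) => //.
move=> _ [_ [c ->] <-]; rewrite preimage_itvoy setTI.
rewrite [X in measurable X](_ : _ = \bigcup_(t in setT) (f t @^-1` `]c, +oo[)).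
  apply: fin_bigcup_measurable => // t _.
  by rewrite -[X in measurable X]setTI; apply: mf => //; exact: measurable_itv.
apply/seteqP; split=> [w /=|w [t _]] /=.
  by have [t -> _] := sup_range_max (fun t => f t w); exists t; rewrite //= in_itv/= andbT.
rewrite in_itv/= andbT => /lt_le_trans; apply.
exact: le_sup_range (fun t => f t w) t.
Qed.

End FiniteSup.

(** * Powers, roots and Markov's inequality for p-th moments *)

Section Roots.
Context {R : realType} (p : R) (p_gt0 : 0 < p).
Local Open Scope ereal_scope.
Implicit Types x y : \bar R.

Lemma poweR_rootK x : 0 <= x -> (x `^ p^-1) `^ p = x.
Proof. by move=> x0; rewrite -poweRrM mulVf ?gt_eqF// poweRe1. Qed.

Lemma le_poweR x y (q : R) : (0 <= q)%R -> 0 <= x -> x <= y -> x `^ q <= y `^ q.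
Proof.
move=> q0 x0 xy; apply: gt0_ler_poweR => //; rewrite in_itv/= leey andbT//.
exact: le_trans xy.
Qed.

Lemma poweR_root_le x y : 0 <= x -> 0 <= y -> x <= y `^ p -> x `^ p^-1 <= y.
Proof.
move=> x0 y0 /(le_poweR (_ : 0 <= p^-1)%R x0) /le_trans; apply.
  by rewrite invr_ge0 ltW.
by rewrite -poweRrM divff ?gt_eqF// poweRe1.
Qed.

End Roots.

Section Moments.
Context {R : realType} {d : measure_display} {Om : measurableType d}.
Context (P : probability Om R).

Lemma expectation_ge0 (f : Om -> R) : (forall w, 0 <= f w) -> (0 <= 'E_P[f])%E.
Proof. by move=> f0; rewrite unlock; apply: integral_ge0 => w _; rewrite lee_fin. Qed.

Lemma Lnorm_expectation (f : Om -> R) (p : R) : (forall w, 0 <= f w) ->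
  ('N[P]_p%:E[EFin \o f] = 'E_P[fun w => (f w `^ p)%R] `^ p^-1)%E.
Proof.
move=> f0; rewrite !unlock; congr (_ `^ _)%E; apply: eq_integral => w _ /=.
by rewrite ger0_norm.
Qed.

(** Markov's inequality for [Z^p] at level (e G)^p: the ratio G^p / (e G)^p is e^(-p). *)
Lemma markov_root (Z : Om -> R) (p G : R) : 1 <= p -> 0 < G ->
  measurable_fun setT Z -> (forall w, 0 <= Z w) ->
  ('E_P[fun w => (Z w `^ p)%R] `^ p^-1 <= G%:E)%E ->
  (P [set w | (expR 1 * G <= Z w)%R] <= (expR (- p))%:E)%E.
Proof.
move=> p1 G0 mZ Z0 EG; have p0 : 0 < p by lra.
set B := [set w | _].
have mB : measurable B by apply: measurable_superlevel.
have Zp0 w : 0 <= Z w `^ p by apply: powR_ge0.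
have EZ : ('E_P[fun w => (Z w `^ p)%R] <= (G `^ p)%:E)%E.
  rewrite -(poweR_rootK p0 (expectation_ge0 Zp0)) -poweR_EFin.
  by apply: le_poweR => //; [exact: ltW|exact: poweR_ge0].
have c0 : 0 < (expR 1 * G) `^ p by rewrite powR_gt0// mulr_gt0// expR_gt0.
have : (((expR 1 * G) `^ p)%:E * P B <= 'E_P[fun w => (Z w `^ p)%R])%E.
  have mI : measurable_fun setT (fun w => (\1_B w)%:E : \bar R).
    by apply/measurable_EFinP; exact: measurable_indic.
  have -> : P B = (\int[P]_w (\1_B w)%:E)%E by rewrite integral_indic// setIT.
  rewrite unlock -ge0_integralZl_EFin ?(ltW c0)//.
  apply: ge0_le_integral => //.
  - by move=> w _; rewrite mule_ge0// lee_fin ltW.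
  - exact: measurable_funeM.
  - by apply/measurable_EFinP; apply: (measurableT_comp (measurable_powR p)).
  - move=> w _; rewrite indicE; case: (boolP (w \in B)) => [|_]; last by rewrite mule0 lee_fin.
    rewrite inE /B /= mule1 lee_fin => h.
    by rewrite ge0_ler_powR ?nnegrE ?(ltW p0) ?Z0// mulr_ge0 ?expR_ge0 ?(ltW G0).
move=> /le_trans/(_ EZ).
have -> : P B = (fine (P B))%:E by rewrite fineK// fin_num_measure.
rewrite -EFinM !lee_fin powRM ?expR_ge0 ?(ltW G0)// -expRM mul1r mulrAC.
rewrite -[leRHS]mul1r ler_pM2r ?powR_gt0// expRN => h.
by rewrite -(ler_pM2l (expR_gt0 p)) divff ?gt_eqF ?expR_gt0.
Qed.

End Moments.

(** * Chaining along a fixed sequence of nets *)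

(* Y s t stands for the norm of X_s - X_t. *)
Section Chaining.
Context {R : realType} {d : measure_display} {Om : measurableType d}.
Context (P : probability Om R) {T : finType} (t0 : T) {m : nat}.
Variables (dd : 'I_m -> T -> T -> R) (Y : T -> T -> Om -> R).
Hypothesis m_gt0 : (0 < m)%N.
Hypothesis dd_metric : forall i, metric (dd i).
Hypothesis mY : forall s t, measurable_fun setT (Y s t).
Hypothesis Y0 : forall s t w, 0 <= Y s t w.
Hypothesis Yid : forall t w, Y t t w = 0.
Hypothesis Ytri : forall s t r w, Y s r w <= Y s t w + Y t r w.
Hypothesis Ytail : forall (s t : T) (u : R), s <> t -> 0 <= u ->
  (P [set w | (\sum_(i < m) u `^ (i.+1%:R^-1) * dd i s t <= Y t s w)%R]
   <= (2 * expR (- u))%:E)%E.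

Let dd_ge0 i s t : 0 <= dd i s t. Proof. exact: metric_ge0. Qed.

Let D (u : R) s t := \sum_(i < m) u `^ (i.+1%:R^-1) * dd i s t.

(** As u^(1/n) <= u for [u >= 1], scaling the parameter of [D] by [u] costs at most a factor [u];
    this reduces the mixed tail to a linear one. *)
Lemma root_le (u x : R) (i : nat) : 1 <= u -> 0 <= x ->
  (u * x) `^ (i.+1%:R^-1) <= u * x `^ (i.+1%:R^-1).
Proof.
move=> u1 x0; rewrite powRM ?(le_trans ler01 u1)// ler_wpM2r ?powR_ge0//.
by apply: ler1_powR => //; rewrite invf_le1 ?ler1n.
Qed.

(** For distinct points, [u * D p s t <= Y t s] forces the mixed-tail event of parameter [u * p], of
    probability at most 2 e^(-u p); [moment_of_tail] applies with [G = D p s t]. *)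
Lemma increment_moment (s t : T) (p : R) : 1 <= p ->
  ('E_P[fun w => (Y t s w `^ p)%R] <= ((80 * D p s t)%R `^ p)%:E)%E.
Proof.
move=> p1; have p0 : 0 < p by lra.
have [->|/eqP st] := eqVneq s t.
  rewrite unlock integral0_eq ?lee_fin ?powR_ge0// => w _.
  by rewrite Yid powR0// gt_eqF.
apply: moment_of_tail => //.
  rewrite /D (bigD1 (Ordinal m_gt0))//= ltr_pwDl ?sumr_ge0//.
    rewrite mulr_gt0 ?powR_gt0// lt_neqAle dd_ge0 andbT eq_sym.
    by apply/eqP => /(metric_eq0 (dd_metric _)).
  by move=> i _; rewrite mulr_ge0// powR_ge0.
move=> u u6.
have u1 : 1 <= u by lra.
apply: le_trans (_ : (P [set w | (D (u * p) s t <= Y t s w)%R] <= _)%E).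
  apply: le_measure; rewrite ?inE.
  - exact: measurable_superlevel.
  - exact: measurable_superlevel.
  - move=> w /=; apply: le_trans; rewrite /D mulr_sumr; apply: ler_sum => i _.
    by rewrite mulrA ler_wpM2r// root_le// ltW.
apply: le_trans (Ytail st _) _; first by rewrite mulr_ge0//; lra.
rewrite lee_fin ler_pM ?expR_ge0 ?ler_nat// ler_expR.
have := mulr_ge0 (ltW p0) (le_trans ler01 u1); lra.
Qed.

Variables (r : nat -> T -> T) (K : nat) (A : R) (S : 'I_m -> R).
Hypothesis r_card : forall k, (#|r k @: T| <= 2 ^ 2 ^ k)%N.
Hypothesis r_id : forall t k, (K <= k)%N -> r k t = t.
Hypothesis r_sum : forall (i : 'I_m) t n,
  \sum_(k < n) 2 `^ (k%:R / i.+1%:R) * dd i t (r k t) <= A * S i.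
Hypothesis S_gt0 : 0 < A * \sum_(i < m) S i.

(** Telescope from level [l] to level [l + K], where [r] is the identity. Each link is routed
    through [t], so every distance from [t] to a net point is used at most twice, whence the 2. *)
Lemma chain_bound (l : nat) (u : R) (t : T) (w : Om) : 1 <= u ->
  (forall k, (l <= k)%N ->
     Y (r k.+1 t) (r k t) w <= D (u * 2 ^+ k) (r k t) (r k.+1 t)) ->
  Y t (r l t) w <= u * (2 * (A * \sum_(i < m) S i)).
Proof.
move=> u1 link; have u0 : 0 <= u by lra.
pose wt (i : 'I_m) (k : nat) : R := 2 `^ (k%:R / i.+1%:R).
have wt0 i k : 0 <= wt i k by apply: powR_ge0.
have wtE (i : 'I_m) k : (2 ^+ k) `^ (i.+1%:R^-1) = wt i k.
  by rewrite /wt -powR_mulrn// powRrM.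
(* Charges the far end of a link to the weight of the next level. *)
have wtS (i : 'I_m) k : wt i k <= wt i k.+1.
  by rewrite /wt ler_powR ?ler1n// ler_wpM2r// ler_nat.
have tele n : Y (r (l + n) t) (r l t) w <= u * \sum_(i < m)
    \sum_(l <= k < l + n) (wt i k * dd i t (r k t) + wt i k.+1 * dd i t (r k.+1 t)).
  elim: n => [|n IH].
    rewrite addn0 Yid mulr_ge0// sumr_ge0// => i _.
    by rewrite sumr_ge0// => k _; rewrite addr_ge0// mulr_ge0.
  rewrite addnS; apply: le_trans (Ytri _ (r (l + n) t) _ _) _.
  apply: le_trans (lerD (link _ (leq_addr n l)) IH) _.
  rewrite /D [X in _ + X]mulr_sumr -big_split/= mulr_sumr; apply: ler_sum => i _.
  rewrite big_nat_recr ?leq_addr//= mulrDr addrC lerD2l.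
  apply: le_trans (_ : u * (wt i (l + n)%N * dd i (r (l + n) t) (r (l + n).+1 t)) <= _).
    by rewrite mulrA ler_wpM2r// -wtE root_le// exprn_ge0.
  rewrite ler_wpM2l//.
  have h1 := metric_triangle (dd_metric i) (r (l + n) t) t (r (l + n).+1 t).
  rewrite (metric_sym (dd_metric i) (r (l + n) t) t) in h1.
  apply: le_trans (ler_wpM2l (wt0 _ _) h1) _.
  by rewrite mulrDr lerD2l ler_wpM2r.
rewrite -{1}(@r_id t (l + K)) ?leq_addl//.
apply: le_trans (tele K) _; rewrite ler_wpM2l//.
rewrite mulr_sumr mulr_sumr; apply: ler_sum => i _.
have term0 k : 0 <= wt i k * dd i t (r k t) by rewrite mulr_ge0.
have -> : 2 * (A * S i) = A * S i + A * S i by ring.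
rewrite big_split/=; apply: lerD.
  apply: le_trans (r_sum i t (l + K)).
  rewrite -(big_mkord xpredT (fun k => wt i k * dd i t (r k t))).
  by rewrite (big_cat_nat (leq0n l) (leq_addr K l))/= lerDr sumr_ge0.
apply: le_trans (r_sum i t (l + K).+1).
rewrite -(big_mkord xpredT (fun k => wt i k * dd i t (r k t))).
rewrite big_nat_recl//=.
rewrite (big_cat_nat (leq0n l) (leq_addr K l))/=.
by rewrite addrA lerDr addr_ge0// sumr_ge0.
Qed.

(** Union bound over the possible links from level [l] on: at level [k] there are at most
    2^(2^(k+1)) 2^(2^k) = 2^(3 2^k), each failing with probability at most 2 e^(-u 2^k), and
    [u >= 6] outweighs the count. *)
Lemma chain_tail (l : nat) (u : R) : 6 <= u ->
  (P [set w | (u * (4 * (A * \sum_(i < m) S i)) <= sup (range (fun t => Y t (r l t) w)))%R]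
   <= (4 * expR (- (u * 2 ^+ l / 2)))%:E)%E.
Proof.
move=> u6; have u1 : 1 <= u by lra.
(* An index is a link at level [l + j]. Levels with [j >= K] are left out because [r] is the
   identity there, equal endpoints because the tail hypothesis concerns distinct points. *)
pose I : finType := ('I_K * (T * T))%type.
pose Q (x : I) := [&& x.2.1 \in r (l + x.1).+1 @: T,
  x.2.2 \in r (l + x.1) @: T & x.2.1 != x.2.2].
pose F (x : I) := [set w | D (u * 2 ^+ (l + x.1)) x.2.2 x.2.1 <= Y x.2.1 x.2.2 w].
apply: le_trans (@measure_le_fin_union _ _ _ P I Q F _ _ _ _) _.
- by apply: measurable_superlevel; apply: measurable_sup_range => // t; apply: mY.
- by move=> x; apply: measurable_superlevel.
(* If no link fails, the chain bound has factor 2, strictly below the threshold with factor 4. *)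
- move=> w /=; apply: contraPP => /forall2NP nF; apply/negP; rewrite -ltNge.
  have [t -> _] := sup_range_max t0 (fun t => Y t (r l t) w).
  apply: le_lt_trans (_ : _ <= u * (2 * (A * \sum_(i < m) S i))) _; last first.
    by rewrite ltr_pM2l ?ltr_pM2r ?ltr_nat//; lra.
  apply: chain_bound => // k lk.
  have D0 a b c : 0 <= D a b c.
    by apply: sumr_ge0 => i _; rewrite mulr_ge0// powR_ge0.
  have [->|ne] := eqVneq (r k.+1 t) (r k t); first by rewrite Yid.
  have kK : (k < K)%N.
    by rewrite ltnNge; apply/negP => Kk; rewrite !r_id ?eqxx// in ne; exact: leqW.
  have jK : (k - l < K)%N by apply: leq_ltn_trans kK; exact: leq_subr.
  have := nF (Ordinal jK, (r k.+1 t, r k t)).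
  rewrite /Q /F /= subnKC// ne !imset_f// => -[//|/negP].
  by rewrite -ltNge => /ltW.
apply: (@le_trans _ _ (\sum_(j < K) (2 * expR (- (u * 2 ^+ l / 2)) / 2 ^+ j)%:E)%E).
  rewrite /Q -(pair_big_dep xpredT (fun (j : 'I_K) (ab : T * T) =>
    [&& ab.1 \in r (l + j).+1 @: T, ab.2 \in r (l + j) @: T & ab.1 != ab.2])
    (fun j ab => P (F (j, ab)))) /=.
  apply: lee_sum => j _.
  pose N := (2 ^ (3 * 2 ^ (l + j)))%N.
  have k_gt0 : 0 <= u * 2 ^+ (l + j) by rewrite mulr_ge0 ?exprn_ge0//; lra.
  apply: (@le_trans _ _ (N%:R * (2 * expR (- (u * 2 ^+ (l + j)))))%:E).
    apply: (@le_trans _ _ (\sum_(ab : T * T | [&& ab.1 \in r (l + j).+1 @: T,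
        ab.2 \in r (l + j) @: T & ab.1 != ab.2])
        (2 * expR (- (u * 2 ^+ (l + j))))%:E)%E).
      apply: lee_sum => -[a b] /= /and3P[_ _ ab].
      by apply: Ytail => //; apply/eqP; rewrite eq_sym.
    rewrite sumEFin lee_fin.
    apply: (@le_trans _ _ (\sum_(ab in [predX r (l + j).+1 @: T & r (l + j) @: T])
        (2 * expR (- (u * 2 ^+ (l + j)))))).
      rewrite [leLHS]big_mkcond [leRHS]big_mkcond; apply: ler_sum => -[a b] _ /=.
      rewrite inE /=; case: (a \in _); case: (b \in _); case: (a != b) => //=;
        by rewrite mulr_ge0// expR_ge0.
    rewrite sumr_const cardX -[leLHS]mulr_natl ler_wpM2r ?mulr_ge0 ?expR_ge0// ler_nat.
    apply: leq_trans (leq_mul (r_card _) (r_card _)) _.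
    by rewrite -expnD leq_exp2l// expnS; lia.
  rewrite lee_fin mulrCA -mulrA ler_wpM2l//.
  have e2 : 2 <= expR 1 :> R by have := expR_ge1Dx (1 : R); lra.
  have NE : N%:R <= expR (3 * 2 ^+ (l + j)) :> R.
    rewrite /N natrX -[in leRHS](natrX _ 2) -[in leRHS]natrM.
    by rewrite -[X in expR X]mul1r expRM_natr lerXn2r// nnegrE ?expR_ge0.
  have jE : expR (- j%:R) <= (2 ^+ j)^-1 :> R.
    rewrite expRN lef_pV2 ?posrE ?expR_gt0 ?exprn_gt0//.
    by rewrite -[j%:R]mul1r expRM_natr lerXn2r// ?nnegrE ?expR_ge0.
  apply: le_trans (ler_wpM2r (expR_ge0 _) NE) _.
  apply: le_trans (ler_wpM2l (expR_ge0 _) jE).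
  rewrite -!expRD ler_expR.
  (* Half of [u * 2^(l+j)] absorbs the count; this inequality splits the other half into
     [u * 2^l / 2] and at least [j], which makes the sum over levels geometric. *)
  have X_ge : 2 ^+ l + j%:R <= 2 ^+ (l + j) :> R.
    rewrite -!natrX -natrD ler_nat expnD.
    have := ltn_expl j (isT : (1 < 2)%N); have : (0 < 2 ^ l)%N by rewrite expn_gt0.
    by nia.
  have h1 : 0 <= (u / 2 - 3) * 2 ^+ (l + j) by rewrite mulr_ge0 ?exprn_ge0//; lra.
  have h2 : 0 <= u / 2 * (2 ^+ (l + j) - (2 ^+ l + j%:R)).
    by rewrite mulr_ge0 ?subr_ge0//; lra.
  have h3 : 0 <= (u / 2 - 1) * j%:R by rewrite mulr_ge0 ?ler0n//; lra.
  lra.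
rewrite sumEFin lee_fin -mulr_sumr.
have := ler_wpM2l (mulr_ge0 (ler0n R 2) (expR_ge0 (- (u * 2 ^+ l / 2)))) (sum_inv_pow2_le R K).
lra.
Qed.

(** Since [p <= 2^(l+1)], the exponent [u * 2^l / 2] is at least [p * u / 4], as [moment_of_tail]
    asks. *)
Lemma chain_moment (l : nat) (p : R) : 1 <= p -> p <= 2 ^+ l.+1 ->
  ('E_P[fun w => (sup (range (fun t => Y t (r l t) w)) `^ p)%R]
   <= ((320 * (A * \sum_(i < m) S i))%R `^ p)%:E)%E.
Proof.
move=> p1 pl.
have -> : 320 * (A * \sum_(i < m) S i) = 80 * (4 * (A * \sum_(i < m) S i)) by ring.
apply: moment_of_tail => //; first by rewrite mulr_gt0.
- by apply: measurable_sup_range => // t; apply: mY.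
- by move=> w; apply: sup_range_ge0.
- move=> u u6; apply: le_trans (chain_tail l u6) _.
  rewrite exprS in pl; rewrite lee_fin ler_wpM2l// ler_expR.
  have : 0 <= u * (2 * 2 ^+ l - p) by rewrite mulr_ge0 ?subr_ge0//; lra.
  by lra.
Qed.

Let root_moment (p : R) t := ('E_P[fun w => (Y t t0 w `^ p)%R] `^ p^-1)%E.

(** The supremum is at most [W + Z], with [Z] the chained part from level [l] on and [W] the
    supremum over the net at level [l]; Minkowski's inequality separates the two. *)
Lemma sup_moment (p : R) : 1 <= p ->
  ('E_P[fun w => sup (range (fun t => Y t t0 w `^ p)%R)] `^ p^-1
   <= (320 * (A * \sum_(i < m) S i))%:E + 2%:E * ereal_sup (range (root_moment p)))%E.
Proof.
move=> p1; have p0 : 0 < p by lra.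
set V := ereal_sup _.
have V_ge t : (root_moment p t <= V)%E by apply: ereal_sup_ubound; exists t.
have V0 : (0 <= V)%E by apply: le_trans (V_ge t0); exact: poweR_ge0.
(* The lower bound on [p] controls the size of the net, the upper one serves [chain_moment]. *)
have [l /andP[lp pl]] : exists l, 2 ^+ l <= p <= 2 ^+ l.+1.
  have ex : exists n, p < 2 ^+ n.
    exists (Num.bound p); apply: lt_le_trans (archi_boundP (ltW p0)) _.
    by rewrite -natrX ler_nat ltnW// ltn_expl.
  case: (ex_minnP ex) => -[|l] lP lmin; first by rewrite expr0 in lP; lra.
  exists l; rewrite (ltW lP) andbT leNgt; apply/negP => /lmin.
  by rewrite ltnn.
pose W w := sup (range (fun t => Y (r l t) t0 w)).
pose Z w := sup (range (fun t => Y t (r l t) w)).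
pose U w := sup (range (fun t => Y t t0 w)).
have mW : measurable_fun setT W by apply: measurable_sup_range => // t; apply: mY.
have mZ : measurable_fun setT Z by apply: measurable_sup_range => // t; apply: mY.
have mU : measurable_fun setT U by apply: measurable_sup_range => // t; apply: mY.
have W0 w : 0 <= W w by apply: sup_range_ge0.
have Z0 w : 0 <= Z w by apply: sup_range_ge0.
have U0 w : 0 <= U w by apply: sup_range_ge0.
have UWZ w : U w <= (W \+ Z) w.
  rewrite /U; have [t -> _] := sup_range_max t0 (fun t => Y t t0 w).
  apply: le_trans (Ytri t (r l t) t0 w) _; rewrite [leRHS]addrC; apply: lerD.
    exact: (le_sup_range t0 (fun t => Y t (r l t) w)).
  exact: (le_sup_range t0 (fun t => Y (r l t) t0 w)).
have mpow (f : Om -> R) : measurable_fun setT f ->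
    measurable_fun setT (fun w => (f w `^ p)%:E).
  by move=> mf; apply/measurable_EFinP; apply: (measurableT_comp (measurable_powR p)).
have -> : (fun w => sup (range (fun t => Y t t0 w `^ p))) = (fun w => U w `^ p).
  by apply/funext => w; rewrite (sup_range_powR t0 (ltW p0) (fun t => Y0 t t0 w)).
have UN : ('E_P[fun w => (U w `^ p)%R] `^ p^-1
    <= 'N[P]_p%:E[EFin \o (W \+ Z)%R])%E.
  rewrite Lnorm_expectation; last by move=> w; rewrite addr_ge0.
  apply: le_poweR; first by rewrite invr_ge0 ltW.
    by apply: expectation_ge0 => w; apply: powR_ge0.
  rewrite unlock; apply: ge0_le_integral => //.
  - by move=> w _; rewrite lee_fin powR_ge0.
  - exact: mpow.
  - by apply: mpow; apply: measurable_funD.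
  - move=> w _; rewrite lee_fin; apply: ge0_ler_powR; rewrite ?nnegrE.
    + exact: ltW.
    + exact: U0.
    + exact: addr_ge0.
    + exact: UWZ.
apply: (le_trans UN); apply: le_trans (minkowski_EFin P mW mZ p1) _.
rewrite addeC; apply: leeD; rewrite Lnorm_expectation//.
  apply: poweR_root_le; first exact: p0.
  - by apply: expectation_ge0 => w; apply: powR_ge0.
  - by rewrite lee_fin; move: S_gt0; lra.
  - by rewrite poweR_EFin; apply: chain_moment.
apply: poweR_root_le; first exact: p0.
- by apply: expectation_ge0 => w; apply: powR_ge0.
- by rewrite mule_ge0.
have EV t : ('E_P[fun w => (Y t t0 w `^ p)%R] <= V `^ p)%E.
  rewrite -[leLHS](poweR_rootK p0); last first.
    by apply: expectation_ge0 => w; apply: powR_ge0.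
  by apply: le_poweR; [exact: ltW|exact: poweR_ge0|exact: V_ge].
(* The power of the supremum is at most the sum over the net points; there are at most 2^(2^l) <=
   2^p of them, and the p-th root of this count is at most 2. *)
apply: (@le_trans _ _ (\sum_(s in r l @: T) 'E_P[fun w => (Y s t0 w `^ p)%R])%E).
  rewrite unlock -big_enum/= -ge0_integral_sum; first last.
  - by move=> s w _; rewrite lee_fin powR_ge0.
  - by move=> s; apply: mpow.
  - by [].
  apply: ge0_le_integral => //.
  - by move=> w _; rewrite lee_fin powR_ge0.
  - exact: mpow.
  - by apply: emeasurable_sum => s; apply: mpow.
  - move=> w _; rewrite /W; have [t -> _] := sup_range_max t0 (fun t => Y (r l t) t0 w).
    rewrite big_enum/= (bigD1 (r l t)) ?imset_f//= leeDl// sume_ge0// => s _.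
    by rewrite lee_fin powR_ge0.
apply: (@le_trans _ _ (\sum_(s in r l @: T) V `^ p)%E).
  by apply: lee_sum => s _; apply: EV.
rewrite (eq_bigr (fun=> 1%:E * V `^ p)%E); last by move=> s _; rewrite mul1e.
rewrite -ge0_sume_distrl// sumEFin sumr_const poweRM// lee_wpmul2r ?poweR_ge0//.
rewrite poweR_EFin lee_fin.
apply: le_trans (_ : (2 ^ 2 ^ l)%N%:R <= _); first by rewrite ler_nat.
by rewrite natrX -powR_mulrn// ler_powR ?ler1n// natrX.
Qed.

End Chaining.

(** * Choice of the constants, degenerate cases, and passage from moments to deviations *)

Theorem theorem2 (R : realType) (m : nat) (m_gt0 : (0 < m)%N) :
  exists C2 C2' C3 : R, [/\ 0 < C2, 0 < C2', 0 < C3 &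
  forall (M N : nat) (I : 'I_M -> nat) (J : 'I_N -> nat)
    (M_gt0 : (0 < M)%N) (N_gt0 : (0 < N)%N)
    (I_gt0 : forall k, (0 < I k)%N) (J_gt0 : forall k, (0 < J k)%N)
    (al : 'rV[R]_#|{: midx J}| -> R) (nrm : tensor R I J -> R)
    (nrm_ui : ui_norm al nrm)
    (d : measure_display) (Om : measurableType d) (P : probability Om R)
    (T : finType) (dd : 'I_m -> T -> T -> R)
    (dd_metric : forall i, metric (dd i))
    (X : T -> Om -> tensor R I J) (X_rv : forall t, tensor_rv (X t))
    (X_tail : mixed_tail P nrm dd X) (t0 : T),
  (forall p : R, 1 <= p ->
    (('E_P[fun w => sup (range (fun t => nrm (X t w - X t0 w) `^ p)%R)])
        `^ p^-1
      <= C2%:E * (\sum_(i < m) gamma i.+1%:R (dd i))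
         + 2%:E * ereal_sup
             (range (fun t =>
                ('E_P[fun w => (nrm (X t w - X t0 w) `^ p)%R]) `^ p^-1)))%E)
  /\
  (* T has at least two points: if T = {t0} the event is 0 >= 0 *)
  ((1 < #|T|)%N -> forall u : R, 1 <= u ->
    (P [set w | C2'%:E * (\sum_(i < m) gamma i.+1%:R (dd i))
                + C3%:E * (\sum_(i < m)
                    (u `^ (i.+1%:R^-1))%:E * diameter (dd i))
                <= (sup (range (fun t => nrm (X t w - X t0 w)%R)))%:E]
      <= (expR (- u))%:E)%E)].
Proof.
have [A A0 net] := joint_admissible_net R m.
have e0 : 0 < expR 1 :> R := expR_gt0 1.
(* [sup_moment] gives [320 * A] times the sum of the [S i], each taken below as twice [gamma]. *)
have [C [C0 CE]] : exists C : R, 0 < C /\ C = 640 * A.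
  by exists (640 * A); split; [apply: mulr_gt0; [rewrite ltr0n|]|].
(* The factors e come from [markov_root]; 160 is twice the 80 of [increment_moment]. *)
exists C, (expR 1 * C), (expR 1 * 160).
split; [exact: C0|exact: mulr_gt0|exact: mulr_gt0|].
move=> M N I J _ _ _ _ al nrm nrm_ui d Om P T dd dm X X_rv X_tail t0.
have nn := ui_norm_norm nrm_ui.
pose Y t s w := nrm (X t w - X s w).
have mY s t : measurable_fun setT (Y s t).
  by apply: measurable_tensor_norm => //; apply: tensor_rvB.
have Y0 s t w : 0 <= Y s t w by apply: tnorm_ge0.
have Yid t w : Y t t w = 0.
  have -> : Y t t w = nrm (tscale 0 0).
    by rewrite /Y subrr; congr nrm; apply/ffunP => ij; rewrite !ffunE mul0r.
  by rewrite (tnormZ nn) normr0 mul0r.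
have Ytri s t r w : Y s r w <= Y s t w + Y t r w.
  by apply: le_trans (tnormD nn _ _); rewrite addrA subrK.
pose V p := ereal_sup (range (fun t => ('E_P[fun w => (Y t t0 w `^ p)%R] `^ p^-1)%E)).
have V0 p : (0 <= V p)%E.
  apply: le_trans (ereal_sup_ubound _); last by exists t0.
  exact: poweR_ge0.
pose g (i : 'I_m) := gamma i.+1%:R (dd i).
have g0 i : (0 <= g i)%E by apply: gamma_ge0.
have moment : (1 < #|T|)%N -> forall p : R, 1 <= p ->
    ('E_P[fun w => sup (range (fun t => Y t t0 w `^ p)%R)] `^ p^-1
     <= C%:E * (\sum_(i < m) g i) + 2%:E * V p)%E.
  move=> T1 p p1.
  have gpos i : (0 < g i)%E by apply: gamma_gt0.
  (* If some [gamma] is infinite, the right-hand side is [+oo]. *)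
  have [fin|] := pselect (forall i, g i \is a fin_num); last first.
    move=> /existsNP[i /negP]; rewrite ge0_fin_numE// -leNgt leye_eq => /eqP gi.
    rewrite (bigD1 i)//= gi addye ?gt0_muley ?lte_fin//; last first.
      by rewrite gt_eqF// (lt_le_trans (ltNyr 0))// sume_ge0.
    rewrite addye ?leey// gt_eqF// (lt_le_trans (ltNyr 0))// mule_ge0//.
  have gE i : g i = (fine (g i))%:E by rewrite fineK.
  pose S i := 2 * fine (g i).
  have fg0 i : 0 < fine (g i) by rewrite -lte_fin -gE.
  have gS i : (g i < (S i)%:E)%E by rewrite gE lte_fin /S; have := fg0 i; lra.
  have [r [K [r_card r_id r_sum]]] := net T t0 dd S dm gS.
  have S0 : 0 < A * \sum_(i < m) S i.
    rewrite mulr_gt0// (bigD1 (Ordinal m_gt0))//= ltr_pwDl ?mulr_gt0//.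
    by apply: sumr_ge0 => i _; rewrite mulr_ge0// ltW.
  have := sup_moment t0 m_gt0 dm mY Y0 Yid Ytri X_tail r_card r_id r_sum S0 p1.
  move=> /le_trans; apply; rewrite leeD2r//.
  rewrite (eq_bigr _ (fun i _ => gE i)) sumEFin -EFinM lee_fin -mulr_sumr CE.
  by lra.
split=> [p p1|T1 u u1].
  (* If [T] is a single point, the left-hand side is 0. *)
  have [T1|T1] := ltnP 1 #|T|; first exact: moment.
  have p0 : 0 < p by lra.
  rewrite [leLHS](_ : _ = 0)%E.
    apply: adde_ge0; apply: mule_ge0; rewrite ?lee_fin ?(ltW C0)//; last exact: V0.
    by apply: sume_ge0 => i _; apply: g0.
  have -> : ('E_P[fun w => sup (range (fun t => Y t t0 w `^ p)%R)] = 0)%E.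
    rewrite unlock integral0_eq// => w _.
    have [t -> _] := sup_range_max t0 (fun t => Y t t0 w `^ p).
    by rewrite (fintype_le1P T1 t0 t) Yid powR0// gt_eqF.
  by rewrite poweR0r// invr_eq0 gt_eqF.
pose diam := (\sum_(i < m) (u `^ (i.+1%:R^-1))%:E * diameter (dd i))%E.
have diam0 i : (0 <= diameter (dd i))%E.
  apply: le_trans (ereal_sup_ubound _); last by exists (t0, t0).
  by rewrite lee_fin (metric_ge0 (dm i)).
have dsum0 : (0 <= diam)%E.
  by apply: sume_ge0 => i _; rewrite mule_ge0// lee_fin powR_ge0.
have V_diam : (V u <= 80%:E * diam)%E.
  apply: ge_ereal_sup => _ [t _ <-].
  apply: (@le_trans _ _ (80%:E * \sum_(i < m)
      (u `^ (i.+1%:R^-1))%:E * (dd i t0 t)%:E)%E); last first.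
    rewrite lee_wpmul2l// lee_sum// => i _; rewrite lee_wpmul2l ?lee_fin ?powR_ge0//.
    by apply: ereal_sup_ubound; exists (t0, t).
  under eq_bigr do rewrite -EFinM.
  rewrite sumEFin -EFinM.
  apply: poweR_root_le; first by lra.
  - by apply: expectation_ge0 => w; apply: powR_ge0.
  - rewrite lee_fin mulr_ge0// sumr_ge0// => i _.
    by rewrite mulr_ge0 ?powR_ge0 ?(metric_ge0 (dm i)).
  - by rewrite poweR_EFin; apply: increment_moment.
pose y := (C%:E * (\sum_(i < m) g i) + 160%:E * diam)%E.
(* [markov_root] needs a positive level; it comes from [gamma], since [T] has two points. *)
have y0 : (0 < y)%E.
  rewrite /y (bigD1 (Ordinal m_gt0))//=.
  apply: (@lt_le_trans _ _ (C%:E * g (Ordinal m_gt0))%E).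
    by rewrite mule_gt0 ?lte_fin//; apply: gamma_gt0.
  apply: le_trans (leeDl _ _); last by rewrite mule_ge0.
  rewrite lee_wpmul2l ?lee_fin ?(ltW C0)// leeDl// sume_ge0//.
have yE : ((expR 1 * C)%:E * (\sum_(i < m) g i) + (expR 1 * 160)%:E * diam
           = (expR 1)%:E * y)%E.
  rewrite !EFinM -!muleA -ge0_muleDr//; apply: mule_ge0 => //.
    by rewrite lee_fin ltW.
  by apply: sume_ge0 => i _; apply: g0.
rewrite yE.
have Ey : (('E_P[fun w => (sup (range (fun t => Y t t0 w)) `^ u)%R]) `^ u^-1 <= y)%E.
  have -> : (fun w => sup (range (fun t => Y t t0 w)) `^ u) =
            (fun w => sup (range (fun t => Y t t0 w `^ u))).
    by apply/funext => w; rewrite (sup_range_powR t0)//; lra.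
  apply: le_trans (moment T1 u u1) _.
  rewrite leeD2l//; apply: le_trans (lee_wpmul2l _ V_diam) _ => //.
  by rewrite muleA -EFinM -natrM.
clear yE; clearbody y; case: y y0 Ey => [y| |]// y0 Ey.
  apply: markov_root => //.
    by apply: measurable_sup_range => // t; apply: mY.
  by move=> w; apply: (sup_range_ge0 t0) => t; apply: (Y0 t t0 w).
(* An infinite threshold is never reached by the real supremum, so the event is empty. *)
rewrite gt0_muley ?lte_fin// [X in P X](_ : _ = set0) ?measure0 ?lee_fin ?expR_ge0//.
by rewrite -subset0 => w.
Qed.
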